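(* We have $$N_{3}(n,r,k)=\genfrac{[}{]}{0pt}{}{n}{k+1}^{-1}\genfrac{[}{]}{0pt}{}{n}{r}\genfrac{[}{]}{0pt}{}{n}{r-1}\genfrac{[}{]}{0pt}{}{n-r}{k}\,q^{r(r+1)+2(n-r-k)},$$ where $N_3(n,r,k)$ is the generating function of the major index over the symmetric Dyck paths of size $n$ with $r$ descents and $k$ half-arches.
   Context: A Dyck path is a word in $\{0,1\}$ with equally many letters $0$ and $1$ in which every prefix contains at least as many $0$'s as $1$'s; it is prime if it is non-empty and returns to balance (equal numbers of $0$'s and $1$'s in a non-empty prefix) only at its end. A Dyck path $\mu=\mu_1\cdots\mu_{2m}$ is symmetric if $\mu=\overline{\mu_{2m}}\cdots\overline{\mu_1}$ with $\overline0=1$, $\overline1=0$. A symmetric Dyck path is identified with its first half $\nu=\mu_1\cdots\mu_m$ (a word of length $m$), from which $\mu$ is recovered uniquely. For $1\le i\le m$ with $\mu_i=0$ let $j>i$ be the minimal integer such that $\mu_j=1$ and $\mu_i\mu_{i+1}\cdots\mu_j$ is a prime Dyck path; the pair $(i,j)$ is an arch if $j\le m$, and $i$ is a half-arch if $j\ge m+1$. The size of a symmetric Dyck path is the number of its arches plus the number of its half-arches; thus a symmetric Dyck path of size $n$ has $n-k$ arches and $k$ half-arches for some $0\le k\le n$. The size is in general different from the length $m$ of the word $\nu$. For $\nu=\nu_1\cdots\nu_m$, the descent set $\mathrm{Des}(\nu)$ consists of all $1\le i\le m-1$ with $(\nu_i,\nu_{i+1})=(1,0)$, together with $m$ if $\nu_m=1$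 ($m$ is not included if $\nu_m=0$); and $\mathrm{maj}(\nu):=\sum_{i\in\mathrm{Des}(\nu)}i$. Let $\mathcal{Q}(n,r,k)$ be the set of symmetric Dyck paths which have size $n$, $r$ descents and $k$ half-arches, and define $$N_3(n,r,k):=\sum_{\nu\in\mathcal{Q}(n,r,k)}q^{\mathrm{maj}(\nu)}.$$ Here $\genfrac{[}{]}{0pt}{}{a}{b}:=\frac{(q)_a}{(q)_b(q)_{a-b}}$ is the $q$-binomial coefficient, with $(q)_a:=(1-q)(1-q^2)\cdots(1-q^a)$.
   Formalization: The case r = 0, k = n is excluded: there the formula inverts the q-binomial [n; n+1] = 0 while [n; r-1] = [n; -1] = 0, so the right-hand side is the undefined 0/0, whereas N_3(n,0,n) = 1. *)

(* Defs.v *)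
From mathcomp Require Import all_boot all_order all_algebra.
From mathcomp Require Import fraction classical_sets fsbigop.

Set Implicit Arguments.
Unset Strict Implicit.
Unset Printing Implicit Defensive.

Import GRing.Theory Num.Theory.

(* Words in {0,1} are boolean sequences: the letter 0 is [false], the letter 1
   is [true], and the bar involution is [negb]. Positions are 1-based. *)
Definition word := seq bool.

Definition letter (w : word) (i : nat) : bool := nth false w i.-1.

(* w_i w_{i+1} ... w_j, for 1 <= i <= j <= size w *)
Definition factor (w : word) (i j : nat) : word := drop i.-1 (take j w).

Definition dyck (w : word) : bool :=
  (count_mem false w == count_mem true w) &&
  all (fun i => count_mem true (take i w) <= count_mem false (take i w))
      (iota 0 (size w).+1).

Definition prime_dyck (w : word) : bool :=
  [&& dyck w, w != [::] &
      all (fun i => count_mem false (take i w) != count_mem true (take i w))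
          (iota 1 (size w).-1)].

Definition sym_dyck (mu : word) : bool := dyck mu && (mu == rev (map negb mu)).

Definition first_half (mu : word) : word := take (size mu)./2 mu.

Definition closes (mu : word) (i j : nat) : bool :=
  [&& i < j <= size mu, letter mu j == true & prime_dyck (factor mu i j)].

Definition matched (mu : word) (i j : nat) : bool :=
  [&& letter mu i == false, closes mu i j &
      all (fun j' => ~~ closes mu i j') (iota 0 j)].

Definition arches (mu : word) : seq (nat * nat) :=
  let m := size (first_half mu) in
  [seq ij <- [seq (i, j) | i <- iota 1 m, j <- iota 1 m] | matched mu ij.1 ij.2].

Definition half_arches (mu : word) : seq nat :=
  let m := size (first_half mu) in
  [seq i <- iota 1 m | has (matched mu i) (iota m.+1 (size mu - m))].

(* This is not the length of the word. *)
Definition path_size (mu : word) : nat := size (arches mu) + size (half_arches mu).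

Definition Des (nu : word) : seq nat :=
  let m := size nu in
  [seq i <- iota 1 m |
     if i < m then (letter nu i, letter nu i.+1) == (true, false)
     else letter nu i == true].

Definition maj (nu : word) : nat := \sum_(i <- Des nu) i.

Local Open Scope classical_set_scope.
Local Open Scope ring_scope.

Definition Q (n r k : nat) : set word :=
  [set mu | [/\ sym_dyck mu, path_size mu = n,
                size (Des (first_half mu)) = r & size (half_arches mu) = k]].

Definition qfield := {fraction {poly rat}}.

Definition q : qfield := tofrac ('X : {poly rat}).

(* A sum over a finite set (arches take two letters of the first half and
   half-arches one, so the first half has length 2n - k): the finitely supported
   sum does not fall back on its default value 0. *)
Definition N3 (n r k : nat) : qfield :=
  \sum_(mu \in Q n r k) q ^+ maj (first_half mu).

Definition qpoch (a : nat) : qfield := \prod_(1 <= i < a.+1) (1 - q ^+ i).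

(* The arguments are integers because the lower index r - 1 may be negative;
   the coefficient is 0 unless 0 <= b <= a. *)
Definition qbinom (a b : int) : qfield :=
  if 0 <= b <= a then qpoch `|a|%N / (qpoch `|b|%N * qpoch `|a - b|%N) else 0.

(* Main.v *)
Require Import Defs.
From mathcomp Require Import all_boot all_order all_algebra.
From mathcomp Require Import fraction classical_sets fsbigop.
From mathcomp Require Import ring lra zify.

(** A symmetric Dyck path is determined by its first half, which can be any
    ballot word: every prefix has at least as many 0s as 1s. Cut each path into
    steps and record the height reached after each of them: the partner of a 0
    is the first return to the height below it. Hence every 1 of the first half
    closes exactly one arch, and every 0 of the first half opens either an arch
    or a half-arch, so a path of size [n] with [k] half-arches is a ballot word
    with [n] zeros and [p = n - k] ones ([size_arches], [path_size_unfold]).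

    It remains to sum [q ^ maj] over ballot words with [n] zeros, [p] ones and
    [r] descents. Such a word is given by the numbers [A_1 < ... < A_r <= n] of
    zeros and [B_1 < ... < B_r = p] of ones that precede its descents (inclusive),
    the ballot condition reads [B_i <= A_i] for all [i], and the major index is
    the sum of all [A_i] and [B_i]. Let [e_r(m)] be the elementary symmetric
    polynomial of degree [r] in [q, ..., q^m]. Exchanging the tails of a pair
    (A, B) at its first violation of [B_i <= A_i] preserves the sum and turns it
    into a pair of subsets of [1..p] and [1..n] with [r + 1] and [r - 1]
    elements, so with [B_r <= p] in place of [B_r = p] the sum is
    [F(p) = e_r(n) e_r(p) - e_{r+1}(p) e_{r-1}(n)], and the required sum is
      [F(p) - F(p-1) = q^p (e_r(n) e_{r-1}(p-1) - e_r(p-1) e_{r-1}(n))].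
    The bijection only explains the formula [ballot_closed]. The proof checks
    that both sides obey the same recursion: deleting the last letter of a ballot
    word changes the major index in a way that depends on the last two letters
    only ([ballot_gf_split], [ballot_gf1_rec]), and the recursion of the [e_r]
    gives the same relation for the closed form ([ballot_closed_rec]).

    Finally [e_r(m)] is [q^(r(r+1)/2)] times a q-binomial coefficient
    ([qelem_qfact]), and the difference of two products factors because
    [1 - (1 - q^t) / (1 - q^(t+k+1)) = q^t (1 - q^(k+1)) / (1 - q^(t+k+1))]
    ([ballot_closed_qfact]). *)

Set Implicit Arguments.
Unset Strict Implicit.
Unset Printing Implicit Defensive.

Import GRing.Theory Num.Theory.

(** * Ballot words *)

Definition ballot (w : word) : bool :=
  all (fun i => count_mem true (take i w) <= count_mem false (take i w))
      (iota 0 (size w).+1).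

Lemma ballotP (w : word) :
  reflect (forall i, count_mem true (take i w) <= count_mem false (take i w))
          (ballot w).
Proof.
apply: (iffP allP) => [wP i|wP i _]; last exact: wP.
have [ltwi|lewi] := ltnP (size w) i; last by apply: wP; rewrite mem_iota.
have := wP (size w); rewrite mem_iota /= ltnSn take_size take_oversize //.
  by apply.
exact: ltnW.
Qed.

Lemma ballot_rcons (w : word) (b : bool) :
  ballot (rcons w b) =
  ballot w && (count_mem true (rcons w b) <= count_mem false (rcons w b)).
Proof.
apply/ballotP/andP => [wP|[/ballotP wP leb] i].
  split; last by have := wP (size w).+1; rewrite take_oversize // size_rcons.
  apply/ballotP=> i; have [ltiw|lewi] := ltnP i (size w).
    by have := wP i; rewrite -cats1 take_cat ltiw.
  rewrite take_oversize //; have := wP (size w).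
  by rewrite -cats1 take_cat ltnn subnn take0 cats0.
have [ltiw|lewi] := ltnP i (size w).
  by rewrite -cats1 take_cat ltiw.
have [->|nei] := eqVneq i (size w).
  by have := wP (size w); rewrite take_size -cats1 take_cat ltnn subnn take0 cats0.
by rewrite take_oversize // size_rcons ltn_neqAle eq_sym nei.
Qed.

Lemma count_mem_le_ballot (w : word) :
  ballot w -> count_mem true w <= count_mem false w.
Proof. by move/ballotP/(_ (size w)); rewrite take_size. Qed.

(** * Descents when a letter is appended *)

(** The descents that do not depend on the convention for the last position:
    appending letters to a word can only add elements at the end of this
    list. *)
Definition inner_Des (w : word) : seq nat :=
  [seq i <- iota 1 (size w).-1 | (letter w i, letter w i.+1) == (true, false)].

Lemma Des_inner (w : word) :
  Des w = inner_Des w ++ (if last false w then [:: size w] else [::]).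
Proof.
rewrite /Des /inner_Des; case/lastP: w => [|w b] //.
rewrite size_rcons -[X in iota 1 X]addn1 iotaD filter_cat /= add1n ltnn; congr (_ ++ _).
  apply/eq_in_filter=> i; rewrite mem_iota add1n => /andP[_ ltiw].
  by rewrite ltiw.
rewrite last_rcons /letter /= nth_rcons ltnn eqxx.
by case: b.
Qed.

Lemma inner_Des_rcons (w : word) (b : bool) :
  inner_Des (rcons w b) =
  inner_Des w ++ (if ~~ b && last false w then [:: size w] else [::]).
Proof.
rewrite /inner_Des size_rcons; case/lastP: w => [|w c]; first by rewrite andbF.
rewrite size_rcons -[X in iota 1 X]addn1 iotaD filter_cat /= add1n; congr (_ ++ _).
  apply/eq_in_filter=> i; rewrite mem_iota add1n => /andP[i0 ltiw].
  rewrite /letter (nth_rcons _ (rcons w c)) [in RHS]nth_rcons size_rcons.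
  rewrite (_ : i.-1 < (size w).+1); last by lia.
  rewrite nth_rcons (_ : i.-1 < size w); last by lia.
  by rewrite /= (nth_rcons _ (rcons w c)) size_rcons ltiw.

rewrite /letter /= !nth_rcons size_rcons ltnSn !ltnn !eqxx last_rcons.
by case: b c => [] [].
Qed.

(** A final 1 is counted as a descent whether it is last or followed by 0. *)
Lemma Des_rcons0 (w : word) : Des (rcons w false) = Des w.
Proof. by rewrite !Des_inner inner_Des_rcons last_rcons cats0. Qed.

Lemma Des_rcons01 (w : word) :
  Des (rcons (rcons w false) true) = rcons (Des w) (size w).+2.
Proof.
rewrite Des_inner inner_Des_rcons !last_rcons cats0 -Des_rcons0.
by rewrite [in RHS]Des_inner last_rcons cats0 !size_rcons cats1.
Qed.

(** In a final run of 1s only the last position is a descent, so a further 1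
    moves that descent one step to the right. *)
Lemma Des_rcons11 (w : word) :
  Des (rcons (rcons w true) true) = rcons (inner_Des w) (size w).+2 /\
  Des (rcons w true) = rcons (inner_Des w) (size w).+1.
Proof.
rewrite !Des_inner !inner_Des_rcons !last_rcons /= !size_rcons !cats0.
by rewrite !cats1.
Qed.

Lemma maj_rcons0 (w : word) : maj (rcons w false) = maj w.
Proof. by rewrite /maj Des_rcons0. Qed.

Lemma maj_rcons01 (w : word) :
  maj (rcons (rcons w false) true) = maj w + (size w).+2.
Proof. by rewrite /maj Des_rcons01 -cats1 big_cat big_seq1. Qed.

Lemma maj_rcons11 (w : word) :
  maj (rcons (rcons w true) true) = (maj (rcons w true)).+1.
Proof.
rewrite /maj; case: (Des_rcons11 w) => -> ->.
by rewrite -!cats1 !big_cat !big_seq1 /= addnS.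
Qed.

(** * Enumerating words *)

Fixpoint words (m : nat) : seq word :=
  if m is m'.+1 then [seq rcons w b | w <- words m', b <- [:: false; true]]
  else [:: [::]].

Lemma mem_words (m : nat) (w : word) : (w \in words m) = (size w == m).
Proof.
elim: m w => [|m IHm] w; first by rewrite inE; case: w.
case/lastP: w => [|w b].
  apply/negbTE/negP=> /allpairsP[[u c] /= [_ _ /esym/(congr1 size)]].
  by rewrite size_rcons.
rewrite size_rcons eqSS -IHm; apply/allpairsP/idP => [[[u c] /= [u_m _]]|w_m].
  by case/rcons_inj=> ->.
by exists (w, b); split=> //=; case: (b).
Qed.

Lemma words_uniq (m : nat) : uniq (words m).
Proof.
elim: m => // m IHm; apply: allpairs_uniq => // -[u b] [v c] _ _ /=.
exact: rcons_inj.
Qed.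

Local Open Scope ring_scope.

Lemma big_words (V : nmodType) (m : nat) (P : pred word) (F : word -> V) :
  \sum_(w <- words m.+1 | P w) F w =
  \sum_(w <- words m | P (rcons w false)) F (rcons w false) +
  \sum_(w <- words m | P (rcons w true)) F (rcons w true).
Proof.
rewrite big_mkcond [words _.+1]/(allpairs _ _ _) big_allpairs_dep /=.
rewrite [X in _ = X + _]big_mkcond [X in _ = _ + X]big_mkcond.
rewrite -big_split /=; apply: eq_bigr => w _.
by rewrite !big_cons big_nil addr0.
Qed.

(** * The recursion for the major index over ballot words *)

Definition ballot_des (n p r : nat) (w : word) : bool :=
  [&& ballot w, count_mem false w == n, count_mem true w == p
    & size (Des w) == r].

Definition ballot_gf (R : comNzRingType) (x : R) (n p r : nat) : R :=
  \sum_(w <- words (n + p) | ballot_des n p r w) x ^+ maj w.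

(** The part of [ballot_gf x n p.+1 r] contributed by words that end in 1. *)
Definition ballot_gf1 (R : comNzRingType) (x : R) (n p r : nat) : R :=
  \sum_(w <- words (n + p) | ballot_des n p.+1 r (rcons w true))
    x ^+ maj (rcons w true).

Lemma count_mem_rcons (a b : bool) (w : word) :
  count_mem a (rcons w b) = (count_mem a w + (b == a))%N.
Proof. by rewrite -cats1 count_cat /= addn0. Qed.

Lemma size_words m w : w \in words m -> size w = m.
Proof. by rewrite mem_words => /eqP. Qed.

Lemma ballot_des_rcons0 (n p r : nat) (w : word) : (p <= n.+1)%N ->
  ballot_des n.+1 p r (rcons w false) = ballot_des n p r w.
Proof.
move=> lepn; rewrite /ballot_des Des_rcons0 ballot_rcons !count_mem_rcons /=.
rewrite addn0 addn1 eqSS; apply/and4P/and4P => -[].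
  by case/andP.
by move=> -> /eqP -> /eqP -> ->; rewrite lepn !eqxx.
Qed.

Lemma sum_ballot_des_rcons0 (R : comNzRingType) (x : R) (n p r : nat) :
  (p <= n.+1)%N ->
  \sum_(w <- words (n + p) | ballot_des n.+1 p r (rcons w false))
    x ^+ maj (rcons w false) = ballot_gf x n p r.
Proof.
move=> lepn; apply: eq_big => [w|w _]; first exact: ballot_des_rcons0.
by rewrite maj_rcons0.
Qed.

Lemma ballot_gf_split (R : comNzRingType) (x : R) (n p r : nat) :
  (p <= n)%N ->
  ballot_gf x n.+1 p.+1 r = ballot_gf x n p.+1 r + ballot_gf1 x n.+1 p r.
Proof.
move=> lepn; rewrite [LHS]/ballot_gf addSn big_words sum_ballot_des_rcons0 //.
by rewrite /ballot_gf1 addSnnS.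
Qed.

Lemma ballot_gf_p0 (R : comNzRingType) (x : R) (n r : nat) :
  ballot_gf x n 0 r = (r == 0%N)%:R.
Proof.
elim: n => [|n IHn].
  rewrite /ballot_gf big_cons big_nil addr0 /ballot_des /= eq_sym /maj big_nil.
  by rewrite expr0; case: eqP.
rewrite /ballot_gf addSn big_words sum_ballot_des_rcons0 // IHn big1 ?addr0 //.
move=> w /and4P[_ _]; rewrite count_mem_rcons addn1 //.
Qed.

Lemma ballot_gf_gt (R : comNzRingType) (x : R) (n p r : nat) :
  (n < p)%N -> ballot_gf x n p r = 0.
Proof.
move=> ltnp; apply: big1 => w /and4P[/count_mem_le_ballot + /eqP c0 /eqP c1 _].
by rewrite c0 c1 leqNgt ltnp.
Qed.

Lemma ballot_gf1_r0 (R : comNzRingType) (x : R) (n p : nat) :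
  ballot_gf1 x n p 0 = 0.
Proof.
apply: big1 => w /and4P[_ _ _]; case: (Des_rcons11 w) => _ ->.
by rewrite size_rcons.
Qed.

(** The words counted on the left are [u01] or [u11]. In [u01] the last 1 is a
    new descent at position [n + p + 2], and [u0] has the descents of [u]. In
    [u11] the last descent of [u1] moves one step to the right, and the words
    [u1] are those with [n + 1] zeros that do not end in 0: this is the
    difference. *)
Lemma ballot_gf1_rec (R : comNzRingType) (x : R) (n p r : nat) : (p <= n)%N ->
  ballot_gf1 x n.+1 p r.+1 =
  x ^+ (n + p).+2 * ballot_gf x n p r +
  x * (ballot_gf x n.+1 p r.+1 - ballot_gf x n p r.+1).
Proof.
move=> lepn; rewrite /ballot_gf1 addSn big_words; congr (_ + _).
  rewrite /ballot_gf big_distrr /= big_seq_cond [RHS]big_seq_cond.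
  apply: eq_big => [w|w /andP[/size_words sw _]].
    apply: andb_id2l => /size_words sw.
    rewrite /ballot_des Des_rcons01 size_rcons eqSS !ballot_rcons !count_mem_rcons /=.
    rewrite !addn0 !addn1 !eqSS; apply/and4P/and4P => -[].
      by case/andP=> /andP[].
    by move=> -> /eqP -> /eqP -> ->; rewrite ltnS lepn (leq_trans lepn) // !eqxx.
  by rewrite maj_rcons01 sw exprD mulrC.
case: p lepn => [|p] lepn.
  rewrite !ballot_gf_p0 subrr mulr0; apply: big1 => w /and4P[_ _].
  by rewrite !count_mem_rcons !addn1 eqSS.
rewrite ballot_gf_split ?(ltnW lepn) // addrC addKr /ballot_gf1 big_distrr addSnnS.
apply: eq_big => [w|w _].
  rewrite /ballot_des !(proj1 (Des_rcons11 w)) !(proj2 (Des_rcons11 w)) !size_rcons.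
  rewrite !ballot_rcons !count_mem_rcons /= !addn0 !addn1 !eqSS.
  apply/and4P/and4P => -[].
    by case/andP=> /andP[-> /= ->].
  case/andP => -> /= _ /eqP -> /eqP -> ->; rewrite !eqxx; split=> //=.
  by rewrite !ltnS; apply/andP; split=> //; apply: ltnW.
by rewrite maj_rcons11 exprS.
Qed.

(** * The closed form in elementary symmetric polynomials *)

(** The elementary symmetric polynomial of degree [r] in [x, x^2, ..., x^n]. *)
Fixpoint qelem (R : comNzRingType) (x : R) (n r : nat) : R :=
  match n, r with
  | _, 0 => 1
  | 0, _.+1 => 0
  | n'.+1, r'.+1 => qelem x n' r'.+1 + x ^+ n * qelem x n' r'
  end.

Lemma qelem0 (R : comNzRingType) (x : R) (n : nat) : qelem x n 0 = 1.
Proof. by case: n. Qed.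

(** The difference [F(p) - F(p - 1)] of two 2 x 2 determinants
    [F(p) = e_r(n) e_r(p) - e_{r+1}(p) e_{r-1}(n)], where [e_r(m)] is
    [qelem x m r]. The cases with a zero say that a word has no descents exactly
    when it has no 1. *)
Definition ballot_closed (R : comNzRingType) (x : R) (n p r : nat) : R :=
  match p, r with
  | 0, 0 => 1
  | 0, _.+1 | _.+1, 0 => 0
  | p'.+1, r'.+1 =>
    x ^+ p * (qelem x n r * qelem x p' r' - qelem x p' r * qelem x n r')
  end.

Lemma ballot_closed_rec (R : comNzRingType) (x : R) (n p r : nat) :
  ballot_closed x n.+1 p.+1 r.+1 =
  ballot_closed x n p.+1 r.+1 +
  (x ^+ (n + p).+2 * ballot_closed x n p r +
   x * (ballot_closed x n.+1 p r.+1 - ballot_closed x n p r.+1)).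
Proof.
case: p => [|p]; case: r => [|r] /=; rewrite ?qelem0 ?addn0 ?addnS ?exprS ?exprD; ring.
Qed.

(** The range [p <= n + 1] includes the line [p = n + 1] just outside the
    ballot region, where the determinant vanishes by symmetry: this is the
    boundary condition of the recursion. *)
Lemma ballot_gfE (R : comNzRingType) (x : R) (n p r : nat) :
  (p <= n.+1)%N -> ballot_gf x n p r = ballot_closed x n p r.
Proof.
elim: n p r => [|n IHn] p r.
  case: p => [|[|p]] // _.
    by rewrite ballot_gf_p0; case: r.
  rewrite ballot_gf_gt //; case: r => //= -[|r] /=; ring.
elim: p r => [|p IHp] r lepn; first by rewrite ballot_gf_p0; case: r.
move: lepn; rewrite ltnS leq_eqVlt => /predU1P[->|lepn].
  rewrite ballot_gf_gt //; case: r => //= r; ring.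
rewrite ballot_gf_split //; case: r => [|r].
  by rewrite IHn // ballot_gf1_r0 addr0.
by rewrite ballot_gf1_rec // ballot_closed_rec !IHn ?IHp //; lia.
Qed.

(** * Evaluation by q-binomial coefficients *)

Definition qfact (R : comNzRingType) (x : R) (n : nat) : R :=
  \prod_(1 <= i < n.+1) (1 - x ^+ i).

Lemma qfactS (R : comNzRingType) (x : R) (n : nat) :
  qfact x n.+1 = qfact x n * (1 - x ^+ n.+1).
Proof. by rewrite /qfact big_nat_recr. Qed.

Lemma qfact0 (R : comNzRingType) (x : R) : qfact x 0 = 1.
Proof. by rewrite /qfact big_geq. Qed.

Lemma qelem_gt (R : comNzRingType) (x : R) (n r : nat) :
  (n < r)%N -> qelem x n r = 0.
Proof.
elim: n r => [|n IHn] [|r] //= ltnr.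
by rewrite !IHn ?mulr0 ?addr0 //; apply: ltnW.
Qed.

(** The q-binomial theorem for coefficients,
    [e_s(s + t) = x^(s(s+1)/2) (x)_{s+t} / ((x)_s (x)_t)], cleared of
    denominators so that it holds in any ring. *)
Lemma qelem_qfact (R : comNzRingType) (x : R) (s t : nat) :
  qelem x (s + t) s * (qfact x s * qfact x t) =
  x ^+ 'C(s.+1, 2) * qfact x (s + t).
Proof.
elim: s t => [|s IHs] t.
  by rewrite qelem0 qfact0 bin_small // expr0 !mul1r.
elim: t => [|t IHt].
  rewrite addn0 /= qelem_gt // add0r !qfactS qfact0.
  have := IHs 0%N; rewrite !addn0 qfact0 !mulr1 => IH.
  transitivity (x ^+ s.+1 * (1 - x ^+ s.+1) * (qelem x s s * qfact x s)).
    by ring.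
  by rewrite IH (binS s.+1) bin1 exprD; ring.
rewrite addSn addnS /= qfactS [qfact x (s + t).+2]qfactS.
have := IHs t.+1; rewrite addnS => IHs1.
have := IHt; rewrite addSn => {}IHt.
rewrite mulrDl.
have -> : qelem x (s + t).+1 s.+1 * (qfact x s * (1 - x ^+ s.+1) * qfact x t.+1) =
  qelem x (s + t).+1 s.+1 * (qfact x s.+1 * qfact x t) * (1 - x ^+ t.+1).
  by rewrite !qfactS; ring.
rewrite IHt.
have -> : x ^+ (s + t).+2 * qelem x (s + t).+1 s *
   (qfact x s * (1 - x ^+ s.+1) * qfact x t.+1) =
   x ^+ (s + t).+2 * (1 - x ^+ s.+1) *
   (qelem x (s + t).+1 s * (qfact x s * qfact x t.+1)) by ring.
rewrite IHs1 (binS s.+1) bin1 !exprD !exprS exprD; ring.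
Qed.

(** The parameters cover all cases [1 <= r <= p <= n]: [r = s + 1] descents,
    [p = s + t + 1] ones and [n = p + k] zeros. The difference of the two terms
    is the first of them times [1 - (1 - x^t) / (1 - x^(t+k+1))]. *)
Lemma ballot_closed_qfact (F : fieldType) (x : F) (s t k : nat) :
  (forall i, 1 - x ^+ i.+1 != 0) ->
  let n := (s + t + k).+1 in
  ballot_closed x n (s + t).+1 s.+1 =
  (qfact x n / (qfact x k.+1 * qfact x (s + t)))^-1 *
  (qfact x n / (qfact x s.+1 * qfact x (t + k))) *
  (qfact x n / (qfact x s * qfact x (t + k).+1)) *
  (qfact x (t + k) / (qfact x k * qfact x t)) *
  x ^+ (s.+1 * s.+2 + 2 * t).
Proof.
move=> x_neq n.
have fact_neq i : qfact x i != 0.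
  by elim: i => [|i IHi]; rewrite ?qfact0 ?oner_eq0 // qfactS mulf_neq0.
have elemE a b : qelem x (a + b) a =
    x ^+ 'C(a.+1, 2) * qfact x (a + b) / (qfact x a * qfact x b).
  by apply: (canRL (mulfK _)); rewrite ?qelem_qfact // mulf_neq0.
have e1 := elemE s.+1 (t + k)%N.
have e2 := elemE s (t + k).+1.
have e3 := elemE s t.
have e4 : qelem x (s + t) s.+1 = x ^+ 'C(s.+2, 2) * qfact x (s + t) *
    (1 - x ^+ t) / (qfact x s.+1 * qfact x t).
  (* The factor [1 - x^t] makes the formula valid for [t = 0], where both
     sides are 0. *)
  case: t {e1 e2 e3 n} => [|t].
    by rewrite qelem_gt ?addn0 // expr0 subrr mulr0 mul0r.
  rewrite -addSnnS elemE (qfactS x t); field.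
  by rewrite x_neq !fact_neq.
rewrite (_ : s.+1 + (t + k) = n)%N in e1; last by rewrite /n addSn addnA.
rewrite (_ : s + (t + k).+1 = n)%N in e2; last by rewrite /n addnS addnA.
rewrite /ballot_closed e1 e2 e3 e4.
have -> : x ^+ (s.+1 * s.+2 + 2 * t) =
    x ^+ (s + t).+1 * x ^+ t * (x ^+ 'C(s.+2, 2) * x ^+ 'C(s.+1, 2)).
  rewrite -!exprD; congr (_ ^+ _).
  have : ('C(s.+2, 2) + 'C(s.+1, 2) = s.+1 * s.+1)%N.
    elim: (s) => // i; rewrite (binS i.+2) (binS i.+1) !bin1; lia.
  lia.
clearbody n; rewrite !qfactS.
have := x_neq k; have := x_neq s; have := x_neq (t + k)%N.
rewrite !exprS !exprD.
move: (fact_neq n) (fact_neq k) (fact_neq s) (fact_neq t) (fact_neq (t + k)%N)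
  (fact_neq (s + t)%N).
move: (qfact x n) (qfact x k) (qfact x s) (qfact x t) (qfact x (t + k)%N)
  (qfact x (s + t)%N) (x ^+ 'C(_, _)) (x ^+ 'C(_, _)) (x ^+ s) (x ^+ t) (x ^+ k).
move=> n' k' s' t' tk st c1 c2 xs xt xk.
by move=> n0 k0 s0 t0 tk0 st0 a b c; field; rewrite n0 k0 s0 t0 tk0 st0 a b c.
Qed.

Lemma one_sub_q_expn_neq0 (i : nat) : 1 - q ^+ i.+1 != 0.
Proof.
rewrite subr_eq0 eq_sym /q -tofracXn -tofrac1 tofrac_eq.
apply/negP=> /eqP/(congr1 (fun u : {poly rat} => size u)).
by rewrite size_polyXn size_poly1.
Qed.

Lemma qbinom_out (a b : int) : ~~ (0 <= b <= a) -> qbinom a b = 0.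
Proof. by rewrite /qbinom => /negbTE->. Qed.

(** The integer arguments are related to natural numbers by equations, since the
    differences that occur are not syntactically casts. *)
Lemma qbinomE (a b : int) (m n p : nat) : a = m -> b = n -> m = (n + p)%N ->
  qbinom a b = qfact q m / (qfact q n * qfact q p).
Proof.
move=> -> -> ->; rewrite /qbinom lez_nat leq_addr /=.
by rewrite (_ : (n + p)%:Z - n%:Z = p) //; lia.
Qed.

Lemma ballot_closed_qbinom (n p r k : nat) : n = (p.+1 + k)%N ->
  ballot_closed q n p.+1 r =
  (qbinom n%:Z (k%:Z + 1))^-1 * qbinom n%:Z r%:Z * qbinom n%:Z (r%:Z - 1) *
  qbinom (n%:Z - r%:Z) k%:Z *
  q ^ (r%:Z * (r%:Z + 1) + 2 * (n%:Z - r%:Z - k%:Z)).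
Proof.
move=> nE; case: r => [|s].
  by rewrite [qbinom _ (0%:Z - 1)]qbinom_out // mulr0 !mul0r.
have [ltps|lesp] := ltnP p s.
  (* More descents than ones: [n - r < k]. *)
  rewrite [qbinom (_ - _) _]qbinom_out; last by lia.
  by rewrite /= (qelem_gt _ ltps) (qelem_gt _ (leqW ltps)) !mulr0 !mul0r subrr mulr0.
have [t tE] : exists t, p = (s + t)%N by exists (p - s)%N; lia.
rewrite (_ : n = (s + t + k).+1) ?tE; last by lia.
rewrite ballot_closed_qfact; last exact: one_sub_q_expn_neq0.
have -> := @qbinomE (s + t + k).+1%:Z (k%:Z + 1) (s + t + k).+1 k.+1 (s + t)%N;
  try lia.
have -> := @qbinomE (s + t + k).+1%:Z s.+1%:Z (s + t + k).+1 s.+1 (t + k)%N;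
  try lia.
have -> := @qbinomE (s + t + k).+1%:Z (s.+1%:Z - 1) (s + t + k).+1 s (t + k).+1%N;
  try lia.
have -> := @qbinomE ((s + t + k).+1%:Z - s.+1%:Z) k%:Z (t + k)%N k t;
  try lia.
have -> : s.+1%:Z * (s.+1%:Z + 1) + 2 * ((s + t + k).+1%:Z - s.+1%:Z - k%:Z) =
  (s.+1 * s.+2 + 2 * t)%N by lia.
by [].
Qed.

Local Close Scope ring_scope.

(** * Symmetric Dyck paths and their first halves *)

Lemma dyckE (w : word) :
  dyck w = (count_mem false w == count_mem true w) && ballot w.
Proof. by []. Qed.

Definition unfold_half (nu : word) : word := nu ++ rev (map negb nu).

Lemma size_unfold_half (nu : word) : size (unfold_half nu) = (size nu).*2.
Proof. by rewrite size_cat size_rev size_map addnn. Qed.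

Lemma first_half_unfold (nu : word) : first_half (unfold_half nu) = nu.
Proof. by rewrite /first_half size_unfold_half doubleK take_size_cat. Qed.

Lemma count_mem_map_negb (b : bool) (w : word) :
  count_mem b (map negb w) = count_mem (~~ b) w.
Proof. by rewrite count_map; apply: eq_count => c /=; case: b c => [] []. Qed.

Lemma count_mem_size (w : word) :
  count_mem false w + count_mem true w = size w.
Proof. by rewrite -(count_predC (pred1 false)); congr (_ + _); apply: eq_count => -[]. Qed.

Lemma unfold_first_half (mu : word) : sym_dyck mu ->
  unfold_half (first_half mu) = mu.
Proof.
case/andP=> /andP[/eqP c01 _] /eqP muE; rewrite /unfold_half /first_half.
set m := (size mu)./2.
have sz : size mu = m.*2.
  by rewrite -count_mem_size c01 addnn /m -count_mem_size c01 addnn doubleK.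
rewrite -[RHS](cat_take_drop m); congr (_ ++ _).
rewrite [in RHS]muE drop_rev size_map sz -addnn addnK.
by rewrite map_take.
Qed.

(** In the second half a prefix [nu ++ u] has the same excess of 0s over 1s as
    the prefix of [nu] that remains after deleting the mirror image of [u]. *)
Lemma sym_dyck_unfold (nu : word) : sym_dyck (unfold_half nu) = ballot nu.
Proof.
rewrite /sym_dyck {2}/unfold_half map_cat rev_cat map_rev revK mapK; last exact: negbK.
rewrite eqxx andbT dyckE.
rewrite !count_cat !count_rev !count_mem_map_negb addnC eqxx /=.
apply/ballotP/ballotP => nuP i.
  have [leim|ltmi] := leqP i (size nu).
    by have := nuP i; rewrite takel_cat.
  by rewrite take_oversize ?(ltnW ltmi) //; have := nuP (size nu); rewrite take_size_cat.
rewrite take_cat; case: ltnP => // lemi.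
rewrite take_rev size_map !count_cat !count_rev -map_drop !count_mem_map_negb.
set j := size nu - _.
have cE b : count_mem b nu = count_mem b (take j nu) + count_mem b (drop j nu).
  by rewrite -count_cat cat_take_drop.
by rewrite !cE addnAC !leq_add2r.
Qed.

(** * Arches and half-arches *)

(** Truncated subtraction is harmless on ballot words, the only ones for which
    heights are used. *)
Definition height (w : word) (t : nat) : nat :=
  count_mem false (take t w) - count_mem true (take t w).

Lemma count_mem_take_letter (b : bool) (w : word) (t : nat) : t < size w ->
  count_mem b (take t.+1 w) = count_mem b (take t w) + (letter w t.+1 == b).
Proof.
by move=> ltt; rewrite (take_nth false ltt) -cats1 count_cat /= addn0.
Qed.

Lemma height0 (w : word) : height w 0 = 0.
Proof. by rewrite /height take0. Qed.

Lemma heightS (w : word) (t : nat) : ballot w -> t < size w ->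
  if letter w t.+1 then height w t = (height w t.+1).+1
  else height w t.+1 = (height w t).+1.
Proof.
move=> /ballotP wP ltt; have := wP t; have := wP t.+1; rewrite /height.
by rewrite !count_mem_take_letter //; case: (letter w t.+1) => /=; lia.
Qed.

Lemma take_factor (w : word) (i j t : nat) : 0 < i <= j ->
  take t (factor w i j) = drop i.-1 (take (minn (i.-1 + t) j) w).
Proof. by case: i => // i _; rewrite /factor take_drop /= addnC -take_min. Qed.

Lemma count_mem_drop_take (b : bool) (w : word) (s t : nat) : s <= t ->
  count_mem b (drop s (take t w)) =
  count_mem b (take t w) - count_mem b (take s w).
Proof.
move=> lest; have -> : take s w = take s (take t w) by rewrite -take_min (minn_idPl lest).
by rewrite -[X in _ = count_mem b X - _](cat_take_drop s) count_cat addKn.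
Qed.

Lemma count_mem_take_le (b : bool) (w : word) (s t : nat) : s <= t ->
  count_mem b (take s w) <= count_mem b (take t w).
Proof.
move=> lest; have -> : take s w = take s (take t w) by rewrite -take_min (minn_idPl lest).
by rewrite -[X in _ <= count_mem b X](cat_take_drop s) count_cat leq_addr.
Qed.

(** A factor that starts with 0 is a prime Dyck path exactly when its end is the
    first return to the height at which it starts; a first return from above is
    a downward step, which is the letter 1. *)
Lemma closesP (w : word) (i j : nat) : ballot w -> 0 < i -> ~~ letter w i ->
  reflect [/\ i < j <= size w, height w j = height w i.-1
            & forall t, i <= t < j -> height w i.-1 < height w t]
          (closes w i j).
Proof.
case: i => // i wb _ li.
have wP := elimT (ballotP w) wb.
have cf b t : i + t <= j -> i < j ->
    count_mem b (take t (factor w i.+1 j)) =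
    count_mem b (take (i + t) w) - count_mem b (take i w).
  by move=> le lt; rewrite take_factor //= (minn_idPl le) count_mem_drop_take ?leq_addr.
have mono b t := @count_mem_take_le b w i (i + t) (leq_addr _ _).
apply: (iffP idP).
  case/and3P=> ij lj /and3P[/andP[/eqP dj /allP bj] _ /allP pj].
  have /andP[ltij lejw] := ij.
  have sf : size (factor w i.+1 j) = j - i.
    by rewrite size_drop size_takel.
  rewrite sf in bj pj.
  have fE : factor w i.+1 j = take (j - i) (factor w i.+1 j).
    by rewrite take_oversize ?sf.
  have hj : height w j = height w i.
    move: dj; rewrite fE !cf; try lia.
    rewrite subnKC; last by lia.
    rewrite /height.
    have := wP i; have := wP j.
    have := @count_mem_take_le true w i j; have := @count_mem_take_le false w i j; lia.
  split=> // t /andP[lit ltj] /=.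
  have tE : t = i + (t - i) by lia.
  have := bj (t - i); have := pj (t - i); rewrite !mem_iota !cf; try lia.
  rewrite -tE; have := mono true (t - i); have := mono false (t - i); rewrite -tE.
  have := wP i; have := wP t; rewrite /height; lia.
case=> ij /= hj ht.
have /andP[ltij lejw] := ij.
have sf : size (factor w i.+1 j) = j - i.
  by rewrite size_drop size_takel.
have fE : factor w i.+1 j = take (j - i) (factor w i.+1 j).
  by rewrite take_oversize ?sf.
apply/and3P; split=> //.
  case: j ltij lejw {ij cf sf fE} hj ht => // j ltij lejw hj ht.
  have := heightS wb lejw; case: (letter w j.+1) => // hS.
  have [eij|nij] := eqVneq i j; first by move: hS hj; rewrite eij; lia.
  have := ht j; rewrite hj in hS; lia.
apply/and3P; split.
- rewrite /dyck; apply/andP; split.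
    rewrite fE !cf; try lia.
    rewrite subnKC; last by lia.
    move: hj; rewrite /height; have := wP i; have := wP j.
    have := @count_mem_take_le true w i j; have := @count_mem_take_le false w i j; lia.
  apply/allP=> t; rewrite sf mem_iota => /andP[_ lt].
  rewrite !cf; try lia.
  have : height w i <= height w (i + t).
    have [->|t0] := eqVneq t 0; first by rewrite addn0.
    have [->|tj] := eqVneq (i + t) j; first by rewrite hj.
    by apply/ltnW/ht; lia.
  rewrite /height; have := mono true t; have := mono false t.
  have := wP i; have := wP (i + t); lia.
- by rewrite -size_eq0 sf; lia.
- apply/allP=> t; rewrite sf mem_iota => /andP[t0 lt].
  rewrite !cf; try lia.
  have : height w i < height w (i + t) by apply/ht; lia.
  rewrite /height; have := mono true t; have := mono false t.
  have := wP i; have := wP (i + t); lia.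
Qed.

Lemma closes_inj_r (w : word) (i j j' : nat) :
  ballot w -> 0 < i -> ~~ letter w i ->
  closes w i j -> closes w i j' -> j = j'.
Proof.
move=> wb i0 li /closesP-/(_ wb i0 li)[ij hj ht] /closesP-/(_ wb i0 li)[ij' hj' ht'].
have := ht j'; have := ht' j; lia.
Qed.

Lemma closes_inj_l (w : word) (i i' j : nat) :
  ballot w -> 0 < i -> 0 < i' -> ~~ letter w i -> ~~ letter w i' ->
  closes w i j -> closes w i' j -> i = i'.
Proof.
move=> wb i0 i0' li li' /closesP-/(_ wb i0 li)[ij hj ht].
move=> /closesP-/(_ wb i0' li')[ij' hj' ht'].
have := ht i'.-1; have := ht' i.-1; lia.
Qed.

(** There is only one first return, so any [j] that closes [i] is minimal. *)
Lemma matchedE (w : word) (i j : nat) : ballot w -> 0 < i ->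
  matched w i j = ~~ letter w i && closes w i j.
Proof.
move=> wb i0; rewrite /matched eqbF_neg; case: (boolP (letter w i)) => //= li.
apply: andb_idr => cij; apply/allP=> j'; rewrite mem_iota /= add0n => ltj'.
by apply/negP=> /(closes_inj_r wb i0 li cij) eqj; rewrite eqj ltnn in ltj'.
Qed.

(** Discrete intermediate value theorem: a path that ends at height 0 has to
    come back from the height reached after the letter [w_i = 0]. *)
Lemma closes_ex_r (w : word) (i : nat) :
  ballot w -> height w (size w) = 0 -> 0 < i <= size w -> ~~ letter w i ->
  exists j, closes w i j.
Proof.
case: i => // i wb hw iw li.
have ex : exists j, (i < j <= size w) && (height w j <= height w i).
  by exists (size w); rewrite hw; lia.
have [j /andP[/andP[ltij lejw] hj] jmin] := ex_minnP ex.
exists j; apply/closesP => //=.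
have hi := heightS wb iw; rewrite (negbTE li) in hi.
have nij : j != i.+1 by apply/eqP=> jE; move: hj; rewrite jE hi; lia.
have above t : i < t < j -> height w i < height w t.
  by move=> tj; rewrite ltnNge; apply/negP=> ht; have := jmin t; lia.
split=> //; first lia.
case: j {jmin} ltij lejw hj nij above => // j ltij lejw hj nij above.
have := heightS wb lejw; have := above j; case: (letter w j.+1); lia.
Qed.

(** The partner of the letter [w_j = 1] follows the last time before [j] at
    which the path was not above its height after [j]; time 0 is such a time. *)
Lemma closes_ex_l (w : word) (j : nat) :
  ballot w -> 0 < j <= size w -> letter w j ->
  exists i, [/\ 0 < i < j, ~~ letter w i & closes w i j].
Proof.
case: j => // j wb /= ltj lj.
have hj := heightS wb ltj; rewrite lj in hj.
have ex : exists s, (s <= j) && (height w s <= height w j.+1).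
  by exists 0; rewrite height0.
have bnd s : (s <= j) && (height w s <= height w j.+1) -> s <= j by case/andP.
have [s /andP[lesj hs] smax] := ex_maxnP ex bnd.
have nsj : s != j by apply/eqP=> sE; move: hs; rewrite sE hj ltnn.
have above t : s < t <= j -> height w j.+1 < height w t.
  by move=> tj; rewrite ltnNge; apply/negP=> ht; have := smax t; lia.
have ltsw : s < size w by lia.
have hS := heightS wb ltsw; have hs1 := above s.+1.
have ls : ~~ letter w s.+1 by apply/negP=> ls; rewrite ls in hS; lia.
rewrite (negbTE ls) in hS.
exists s.+1; split=> //; first lia.
apply/closesP => //=; split; [lia | lia | move=> t st; have := above t; lia].
Qed.

Lemma count_has_unique (T : eqType) (P : pred T) (s : seq T) : uniq s ->
  (forall x y, x \in s -> y \in s -> P x -> P y -> x = y) -> count P s = has P s.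
Proof.
elim: s => //= x s IHs /andP[xs us] inj.
rewrite IHs //; last by move=> y z ys zs; apply: inj; rewrite inE ?ys ?zs orbT.
case: (boolP (P x)) => //= Px.
rewrite (_ : has P s = false) //; apply/hasPn=> y ys; apply/negP=> Py.
have xy : x = y by apply: inj; rewrite ?inE ?eqxx ?ys ?orbT.
by rewrite -xy (negbTE xs) in ys.
Qed.

Lemma count_letter (b : bool) (w : word) :
  count (fun j => letter w j == b) (iota 1 (size w)) = count_mem b w.
Proof.
rewrite -[in RHS](mkseq_nth false w) /mkseq count_map.
rewrite -[iota 1 _]/(iota (1 + 0) _) iotaDl count_map.
by apply: eq_count => j.
Qed.

Section UnfoldedArches.
Variable nu : word.
Hypothesis nu_ballot : ballot nu.
Let mu := unfold_half nu.

Lemma ballot_unfold : ballot mu.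
Proof. by have := nu_ballot; rewrite -sym_dyck_unfold => /andP[/andP[]]. Qed.

Lemma height_unfold_end : height mu (size mu) = 0.
Proof.
have := nu_ballot; rewrite -sym_dyck_unfold => /andP[/andP[/eqP c01 _] _].
by rewrite /height take_size c01 subnn.
Qed.

Lemma letter_unfold (i : nat) : 0 < i <= size nu -> letter mu i = letter nu i.
Proof. by case: i => // i /= lti; rewrite /letter nth_cat /= lti. Qed.

Lemma count_letter_unfold (b : bool) :
  count (fun j => letter mu j == b) (iota 1 (size nu)) = count_mem b nu.
Proof.
rewrite -count_letter; apply: eq_in_count => j; rewrite mem_iota add1n => ji.
by rewrite letter_unfold.
Qed.

Lemma count_matched_l (j : nat) : 0 < j <= size nu ->
  count (fun i => matched mu i j) (iota 1 (size nu)) = letter mu j.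
Proof.
move=> jm; rewrite count_has_unique ?iota_uniq //; last first.
  move=> i i'; rewrite !mem_iota => /andP[i0 _] /andP[i0' _].
  rewrite !matchedE ?ballot_unfold // => /andP[li cij] /andP[li' cij'].
  exact: closes_inj_l ballot_unfold i0 i0' li li' cij cij'.
congr nat_of_bool; apply/hasP/idP => [[i]|lj].
  rewrite mem_iota => /andP[i0 _]; rewrite matchedE ?ballot_unfold //.
  by case/andP=> _ /and3P[_ /eqP].
have [|i [ij li cij]] := closes_ex_l ballot_unfold _ lj.
  by rewrite size_unfold_half; lia.
exists i; first by rewrite mem_iota; lia.
by rewrite matchedE ?ballot_unfold ?li //; lia.
Qed.

(** The partner of a 0 in the first half lies in one of the two halves. In
    the second half its existence is tested by [has], as in the definition of
    half-arches. *)
Lemma count_matched_r (i : nat) : 0 < i <= size nu ->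
  count (matched mu i) (iota 1 (size nu)) +
    has (matched mu i) (iota (size nu).+1 (size mu - size nu)) = ~~ letter mu i.
Proof.
move=> im; have i0 : 0 < i by case/andP: im.
have inj s : {in s &, forall j j', matched mu i j -> matched mu i j' -> j = j'}.
  move=> j j' _ _; rewrite !matchedE ?ballot_unfold // => /andP[li cij] /andP[_ cij'].
  exact: closes_inj_r ballot_unfold i0 li cij cij'.
rewrite -(count_has_unique (iota_uniq _ _)); last exact: inj.
rewrite -add1n -count_cat -iotaD subnKC; last by rewrite size_unfold_half; lia.
rewrite count_has_unique ?iota_uniq //; last exact: inj.
congr nat_of_bool; apply/hasP/idP => [[j _]|li].
  by rewrite matchedE ?ballot_unfold // => /andP[].
have [|j cij] := closes_ex_r ballot_unfold height_unfold_end _ li.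
  by rewrite size_unfold_half; lia.
exists j; last by rewrite matchedE ?ballot_unfold ?li.
by rewrite mem_iota; case/and3P: cij => /andP[]; lia.
Qed.

Lemma size_archesE :
  size (arches mu) =
  \sum_(i <- iota 1 (size nu)) count (matched mu i) (iota 1 (size nu)).
Proof.
rewrite /arches first_half_unfold size_filter -sum1_count big_mkcond big_allpairs_dep /=.
by apply: eq_bigr => i _; rewrite -big_mkcond sum1_count.
Qed.

(** Double counting: arches are indexed by their 1s. *)
Lemma size_arches : size (arches mu) = count_mem true nu.
Proof.
rewrite size_archesE; under eq_bigr do rewrite -sum1_count big_mkcond.
rewrite exchange_big /= -count_letter_unfold -sum1_count [RHS]big_mkcond.
rewrite big_seq [RHS]big_seq; apply: eq_bigr => j; rewrite mem_iota add1n => jm.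
by rewrite -big_mkcond sum1_count count_matched_l // eqb_id; case: letter.
Qed.

(** Arches and half-arches together are indexed by the 0s of the first half. *)
Lemma path_size_unfold : path_size mu = count_mem false nu.
Proof.
rewrite /path_size size_archesE /half_arches first_half_unfold size_filter.
rewrite -count_letter_unfold -!sum1_count [X in _ + X]big_mkcond -big_split /=.
rewrite [RHS]big_mkcond big_seq [RHS]big_seq.
apply: eq_bigr => i; rewrite mem_iota add1n => im.
rewrite eqbF_neg -[LHS]/(_ + _); have := count_matched_r im.
by case: has; case: (letter mu i) => /=.
Qed.

Lemma size_half_arches : size (half_arches mu) = count_mem false nu - count_mem true nu.
Proof. by rewrite -path_size_unfold -size_arches addKn. Qed.

End UnfoldedArches.

Local Open Scope ring_scope.

(** * The generating function *)

Lemma N3_ballot_gf (n r k : nat) :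
  (k <= n)%N -> N3 n r k = ballot_gf q n (n - k) r.
Proof.
move=> lekn; rewrite /N3.
pose s := [seq unfold_half nu | nu <- words (n + (n - k)) & ballot_des n (n - k) r nu].
have s_uniq : uniq s.
  rewrite map_inj_uniq ?filter_uniq ?words_uniq //.
  exact: can_inj first_half_unfold.
rewrite (_ : Q n r k = [set` s]%classic); last first.
  apply/seteqP; split=> mu /=.
    case=> mu_sym psz des har.
    have muE := unfold_first_half mu_sym; rewrite -muE in mu_sym psz har.
    rewrite sym_dyck_unfold in mu_sym.
    rewrite path_size_unfold // in psz; rewrite size_half_arches // in har.
    rewrite -muE map_f // mem_filter mem_words /ballot_des mu_sym psz des !eqxx /=.
    have := count_mem_le_ballot mu_sym; rewrite -count_mem_size psz => le10.
    have -> : count_mem true (first_half mu) = (n - k)%N.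
      by rewrite -har psz subKn.
    by rewrite !eqxx.
  case/mapP=> nu; rewrite mem_filter => /andP[/and4P[nub /eqP c0 /eqP c1 /eqP des] _] ->.
  rewrite /Q /= sym_dyck_unfold path_size_unfold // size_half_arches //.
  by rewrite first_half_unfold c0 c1 subKn.
rewrite -fsbig_seq // big_map big_filter; apply: eq_bigr => nu _.
by rewrite first_half_unfold.
Qed.

Lemma N3_0 (n r k : nat) : (n < k)%N -> N3 n r k = 0.
Proof.
move=> ltnk; rewrite /N3 fsbig1 // => mu [_ psz _ har].
by move: ltnk; rewrite -psz -har /path_size ltnNge leq_addl.
Qed.

Theorem theorem6p7 (n r k : nat) (hrk : ~ (r = 0%N /\ k = n)) :
  N3 n r k =
  (qbinom n%:Z (k%:Z + 1))^-1 * qbinom n%:Z r%:Z * qbinom n%:Z (r%:Z - 1) *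
  qbinom (n%:Z - r%:Z) k%:Z *
  q ^ (r%:Z * (r%:Z + 1) + 2 * (n%:Z - r%:Z - k%:Z)).
Proof.
have [ltkn|ltnk|eqkn] := ltngtP k n.
- rewrite N3_ballot_gf 1?ltnW // ballot_gfE; last by lia.
  have -> : (n - k = (n - k).-1.+1)%N by lia.
  by apply: ballot_closed_qbinom; lia.
- by rewrite N3_0 // [qbinom (_ - _) _]qbinom_out ?mulr0 ?mul0r //; lia.
rewrite eqkn N3_ballot_gf // subnn ballot_gf_p0 [qbinom _ (_ + 1)]qbinom_out; last by lia.
by rewrite invr0 !mul0r; case: eqP hrk => // r0 []; rewrite eqkn.
Qed.
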